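(* Let $N\ge 1$ agents with states $\theta_1(t),\dots,\theta_N(t)\in S^1$, $t\in\mathbb{Z}_{\ge 0}$, be interconnected according to a (possibly time-varying, discrete-time) $\delta$-digraph $\mathbb{G}(t)$ on the vertex set $\{1,\dots,N\}$, with weights $a_{jk}(t)$, which is uniformly connected. Fix a finite $\beta>0$. Suppose the agents apply the directed Gossip Algorithm: at each time $t$, (1) each agent $k$ randomly selects at most one in-neighbor, selecting the in-neighbor $j$ with probability $a_{jk}(t)/\bigl(\beta+\sum_{l=1}^N a_{lk}(t)\bigr)$, and selecting no agent with the remaining probability $\beta/\bigl(\beta+\sum_{l=1}^N a_{lk}(t)\bigr)$; (2) $\theta_k(t+1)=\theta_j(t)$ if agent $k$ selected $j$ at time $t$, and $\theta_k(t+1)=\theta_k(t)$ if it selected no agent. Then the agents asymptotically synchronize with probability $1$, that is: for any initial condition, any $\varepsilon>0$ and any $\kappa\in(0,1)$, there exists a time $T$ such that for all $t\ge T$ the maximal distance $|\theta_k(t)-\theta_j(t)|$ on $S^1$ between any pair of agents is smaller than $\varepsilon$ with probability larger than $\kappa$.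
   Context: $S^1=\mathbb{R}/2\pi\mathbb{Z}$. A time-varying weighted digraph on $\{1,\dots,N\}$ is given by weights $a_{jk}(t)\ge 0$, where $a_{jk}(t)>0$ if and only if $(j,k)$ is a directed edge from $j$ to $k$ at time $t$ (then $j$ is an in-neighbor of $k$ at time $t$); there are no self-loops. It is a $\delta$-digraph if the weights are bounded (uniformly in $t$) and there is a constant $\delta>0$ with $a_{jk}(t)\ge\delta$ for every edge $(j,k)$ present at time $t$, for all $t$. A digraph is root-connected with root $k$ if there is a directed path from $k$ to every other vertex. The $\delta$-digraph $\mathbb{G}(t)$ is uniformly connected if there exist a time horizon $T_0\in\mathbb{Z}_{\ge 0}$ and a vertex $k$ such that for all $t$ the digraph $\bar{\mathbb{G}}(t)$, whose edges are all the edges appearing in $\mathbb{G}(\tau)$ for some $\tau\in[t,t+T_0]$, is root-connected with root $k$. The graph sequence $\mathbb{G}(t)$ is given (deterministic), and the random selections are made independently by different agents and at different times. *)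

(* Defs.v *)
From HB Require Import structures.
From mathcomp Require Import all_boot all_order all_algebra.
From mathcomp Require Import all_classical all_reals all_analysis.

Set Implicit Arguments.
Unset Strict Implicit.
Unset Printing Implicit Defensive.
Import Order.TTheory GRing.Theory Num.Theory.

Local Open Scope classical_set_scope.
Local Open Scope ring_scope.

Section Circle.
Variable R : realType.

Definition two_pi_int : {pred R} :=
  [pred x | `[< exists m : int, x = 2 * pi * m%:~R >]].

Lemma two_pi_int_zmod : zmod_closed two_pi_int.
Proof.
split; first by apply/asboolP; exists 0; rewrite mulr0.
move=> x y /asboolP[m ->] /asboolP[n ->]; apply/asboolP.
by exists (m - n); rewrite rmorphB mulrBr.
Qed.

HB.instance Definition _ :=
  GRing.isZmodClosed.Build R two_pi_int two_pi_int_zmod.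

Definition circle := Quotient.quot two_pi_int.
HB.instance Definition _ := GRing.Zmodule.on circle.
HB.instance Definition _ := Quotient.on circle.

(* The distance induced on R/(2 pi Z) by the absolute value of R, i.e. the
   length of the shorter arc; it takes values in [0, pi]. *)
Definition circle_norm (x : circle) : R :=
  inf [set `|r| | r in [set r : R | (\pi_circle r)%qT = x]].

Definition circle_dist (x y : circle) : R := circle_norm (x - y).

Definition max_dist (N : nat) (theta : 'I_N -> circle) : R :=
  \big[Num.max/0]_(p : 'I_N * 'I_N) circle_dist (theta p.1) (theta p.2).

End Circle.

Section Digraph.
Variables (R : realType) (N : nat).

(* [a t j k] is the weight at time [t] of the edge from [j] to [k]. *)
Implicit Type a : nat -> 'I_N -> 'I_N -> R.

Definition edge a (t : nat) : rel 'I_N := fun j k => 0 < a t j k.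

Definition is_delta_digraph a : Prop :=
  [/\ forall t j k, 0 <= a t j k,
      forall t k, ~~ edge a t k k,
      exists M : R, forall t j k, a t j k <= M
    & exists2 delta : R, 0 < delta &
        forall t j k, edge a t j k -> delta <= a t j k].

(* the edges appearing at some time of [t, t + T0] *)
Definition union_edge a (T0 t : nat) : rel 'I_N :=
  fun j k => [exists s : 'I_T0.+1, edge a (t + s) j k].

Definition root_connected (e : rel 'I_N) (k : 'I_N) : Prop :=
  forall j, connect e k j.

Definition uniformly_connected a : Prop :=
  exists (T0 : nat) (k : 'I_N), forall t, root_connected (union_edge a T0 t) k.

End Digraph.

(* The outcome of one selection: [Some j] if agent [j] is selected, [None] if
   no agent is; equipped with the discrete sigma-algebra. *)
Definition selection (N : nat) : Type := option 'I_N.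
HB.instance Definition _ (N : nat) := Choice.on (selection N).
HB.instance Definition _ (N : nat) := isPointed.Build (selection N) None.
HB.instance Definition _ (N : nat) := @isMeasurable.Build
  default_measure_display (selection N) discrete_measurable
  discrete_measurable0 discrete_measurableC discrete_measurableU.

Definition mutually_independent (R : realType)
    (d : measure_display) (Omega : measurableType d) (P : probability Omega R)
    (d' : measure_display) (E : measurableType d')
    (I : choiceType) (X : I -> {RV P >-> E}) : Prop :=
  forall (s : seq I) (B : I -> set E), uniq s -> (forall i, measurable (B i)) ->
    P (\bigcap_(i in [set` s]) (X i @^-1` B i)) =
    (\prod_(i <- s) P (X i @^-1` B i))%E.

Section Gossip.
Variables (R : realType) (N : nat).
Variables (d : measure_display) (Omega : measurableType d).
Variable P : probability Omega R.

(* [sel t k] is the random selection of agent [k] at time [t]. As [a t j k = 0]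
   when [j] is not an in-neighbor of [k], such a [j] is selected with
   probability 0. *)
Definition gossip_selections (a : nat -> 'I_N -> 'I_N -> R) (beta : R)
    (sel : nat -> 'I_N -> {RV P >-> selection N}) : Prop :=
  [/\ forall t k j, P (sel t k @^-1` [set (Some j : selection N)]) =
        (a t j k / (beta + \sum_(l < N) a t l k))%:E,
      forall t k, P (sel t k @^-1` [set (None : selection N)]) =
        (beta / (beta + \sum_(l < N) a t l k))%:E
    & mutually_independent (fun tk : nat * 'I_N => sel tk.1 tk.2)].

Fixpoint gossip_state (sel : nat -> 'I_N -> {RV P >-> selection N})
    (theta0 : 'I_N -> circle R) (t : nat) (omega : Omega) : 'I_N -> circle R :=
  if t isn't t'.+1 then theta0 else
  fun k => let theta := gossip_state sel theta0 t' omega in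
    if (sel t' k omega : option 'I_N) is Some j then theta j else theta k.

End Gossip.

(* Main.v *)
(* Over one connectivity window, some edge of the union graph leaves the set of
   agents already holding the root's value, so the selection pattern in which
   only the head of that edge picks its tail enlarges this set by one. Hence N
   windows in a row admit a selection pattern forcing consensus, and consensus
   persists. All admissible selections have probability at least some c > 0,
   so such a pattern occurs in a block of N windows with probability at least
   some q > 0, whatever the block; the blocks being independent, no consensus
   after n blocks has probability at most (1 - q)^n. *)

Require Import Defs.
From mathcomp Require Import all_boot all_order all_algebra.
From mathcomp Require Import all_classical all_reals all_analysis.
Import Order.TTheory GRing.Theory Num.Theory.

Local Open Scope classical_set_scope.
Local Open Scope ring_scope.

Set Implicit Arguments.
Unset Strict Implicit.

(** * Deterministic spread of the root's state under prescribed selections *)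

Lemma connect_exit (T : finType) (e : rel T) (S : {set T}) (x y : T) :
  connect e x y -> x \in S -> y \notin S ->
  exists u v, [/\ u \in S, v \notin S & e u v].
Proof.
move=> /connectP[p + ->]; elim: p x => [|z p IHp] x /= => [_ ->//|].
move=> /andP[exz pz] xS yS; have [zS|zS] := boolP (z \in S).
  exact: IHp pz zS yS.
by exists x, z.
Qed.

Section Broadcast.
Variables (R : realType) (N : nat) (a : nat -> 'I_N -> 'I_N -> R).
Implicit Types (w x : nat -> 'I_N -> option 'I_N).

(** The update rule stripped of probability; states are only copied, so [C] needs no structure. *)
Definition driven (C : Type) x (theta : nat -> 'I_N -> C) : Prop :=
  forall t k, theta t.+1 k = if x t k is Some j then theta t j else theta t k.

Definition admissible w : Prop := forall t k j, w t k = Some j -> edge a t j k.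

Lemma driven_idle (C : Type) x (theta : nat -> 'I_N -> C) k t n :
  driven x theta -> (forall s, (t <= s < t + n)%N -> x s k = None) ->
  theta (t + n)%N k = theta t k.
Proof.
move=> dx; elim: n => [|n IHn] xN; first by rewrite addn0.
rewrite addnS dx xN ?leq_addr ?addnS //=; apply: IHn => s /andP[ts sn].
by apply: xN; rewrite ts addnS ltnS ltnW.
Qed.

(** The pattern [w] idles except for one copy along an edge leaving [S]. It is fixed before [x],
    [theta] and [v], so it depends on the digraph and on [S] but not on the states. *)
Lemma window_broadcast (C : Type) T0 k t (S : {set 'I_N}) :
  root_connected (union_edge a T0 t) k -> k \in S ->
  exists w (S' : {set 'I_N}),
    [/\ admissible w, k \in S', (minn #|S|.+1 N <= #|S'|)%N
      & forall x (theta : nat -> 'I_N -> C) v, driven x theta ->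
        (forall s l, (t <= s < t + T0.+1)%N -> x s l = w s l) ->
        (forall i, i \in S -> theta t i = v) ->
        forall i, i \in S' -> theta (t + T0.+1)%N i = v].
Proof.
move=> rootk kS; have [SN|SN] := leqP N #|S|.
  exists (fun _ _ => None), S; split=> //; first by rewrite geq_min SN orbT.
  move=> x theta v dx xw thS i iS; rewrite (driven_idle dx) ?thS // => s st.
  exact: xw.
have [j jS] : exists j, j \notin S.
  apply/existsP; rewrite -negb_forall; apply: contraL SN => /forallP allS.
  rewrite -leqNgt -[leqLHS]card_ord -cardsT; apply/subset_leq_card/fintype.subsetP => i _.
  exact: allS.
(* A path from [k] to the outsider [j] must leave [S]; [s] is the offset in the window at which the
   exit edge is present. *)
have [u [v [uS vS /existsP[s euv]]]] := connect_exit (rootk j) kS jS.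
pose w s' l := if (s' == t + s)%N && (l == v) then Some u else None.
exists w, (v |: S); split.
- by move=> t' l i; rewrite /w; case: ifP => // /andP[/eqP-> /eqP->] [<-].
- by rewrite in_setU1 kS orbT.
- by rewrite cardsU1 vS geq_min leqnn.
move=> x theta c dx xw thS i.
have idleS l : l \in S -> forall s', (t <= s' < t + T0.+1)%N -> x s' l = None.
  move=> lS s' st; rewrite xw // /w; case: eqP => //= _; case: eqP => // lv.
  by rewrite -lv lS in vS.
rewrite in_setU1 => /orP[/eqP->|iS]; last first.
  by rewrite (driven_idle dx) ?thS //; exact: idleS.
have sT : (s < T0.+1)%N by [].
(* Split the window just after the copy: [v] then idles for [T0 - s] steps, while its source [u],
   being in [S], idled from time [t] on. *)
have -> : (t + T0.+1 = (t + s).+1 + (T0 - s))%N.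
  by rewrite -addnS -addnA addSn subnKC.
rewrite (driven_idle dx) //; last first.
  move=> s' /andP[ss' s'T]; rewrite xw.
    by rewrite /w gtn_eqF.
  rewrite (leq_trans _ ss') ?(leq_trans (leq_addr s t)) //=.
  by move: s'T; rewrite -addnS -addnA addSn subnKC.
rewrite dx xw ?leq_addr ?ltn_add2l // /w !eqxx /= (driven_idle dx) ?thS //.
move=> s' /andP[ts' s's]; apply: idleS => //.
by rewrite ts' (ltn_trans s's) // ltn_add2l.
Qed.

(** Windows are chained from the singleton of the root, whence [n.+1] in the bound; the patterns are
    glued in time. *)
Lemma iter_window_broadcast (C : Type) T0 k t n :
  (forall t, root_connected (union_edge a T0 t) k) ->
  exists w (S : {set 'I_N}),
    [/\ admissible w, k \in S, (minn n.+1 N <= #|S|)%N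
      & forall x (theta : nat -> 'I_N -> C), driven x theta ->
        (forall s l, (t <= s < t + n * T0.+1)%N -> x s l = w s l) ->
        forall i, i \in S -> theta (t + n * T0.+1)%N i = theta t k].
Proof.
move=> rootk; elim: n => [|n [w [S [adw kS Sn wS]]]].
  exists (fun _ _ => None), [set k]%SET; split=> //.
  - by rewrite set11.
  - by rewrite cards1 geq_min.
  - by move=> x theta _ _ i /set1P->; rewrite addn0.
have [w' [S' [adw' kS' S'n wS']]] :=
  window_broadcast C (rootk (t + n * T0.+1)%N) kS.
exists (fun s => if (s < t + n * T0.+1)%N then w s else w' s), S'; split=> //.
- by move=> s l j; case: ifP => _; [exact: adw|exact: adw'].
- apply: leq_trans S'n; rewrite leq_min geq_minr andbT.
  have [nN|nN] := leqP n.+2 N.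
    by rewrite ltnS; apply: leq_trans Sn; rewrite leq_min leqnn ltnW.
  rewrite (leq_trans _ (leqnSn _)) //.
  by apply: leq_trans Sn; rewrite leq_min leqnn -ltnS nN.
move=> x theta dx xw i iS'.
rewrite mulSn [(T0.+1 + _)%N]addnC addnA.
apply: (wS' x) iS' => // [s l /andP[ts sT]|j jS].
  rewrite xw ?ltnNge ?ts // (leq_trans (leq_addr _ _) ts) /=.
  by rewrite mulSn [(T0.+1 + _)%N]addnC addnA -ltnNge.
apply: (wS x) jS => // s l /andP[ts sn].
by rewrite xw ?sn // ts mulSn addnCA (leq_trans sn) ?leq_addl.
Qed.

Lemma broadcast (C : Type) T0 k t :
  (forall t, root_connected (union_edge a T0 t) k) ->
  exists2 w, admissible w &
    forall x (theta : nat -> 'I_N -> C), driven x theta ->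
      (forall s l, (t <= s < t + N * T0.+1)%N -> x s l = w s l) ->
      forall i, theta (t + N * T0.+1)%N i = theta t k.
Proof.
move=> rootk.
have [w [S [adw _ SN wS]]] := iter_window_broadcast C t N rootk.
exists w => // x theta dx xw i; apply: (wS x) => //.
have /eqP -> : S == [set: 'I_N]%SET; last by rewrite inE.
rewrite eqEcard finset.subsetT cardsT card_ord.
by apply: leq_trans SN; rewrite leq_min leqnn leqnSn.
Qed.

Lemma driven_consensus (C : Type) x (theta : nat -> 'I_N -> C) c t n :
  driven x theta -> (forall i, theta t i = c) -> forall i, theta (t + n)%N i = c.
Proof.
move=> dx thc; elim: n => [|n IHn] i; first by rewrite addn0.
by rewrite addnS dx; case: (x _ _).
Qed.

End Broadcast.

Lemma max_dist_consensus (R : realType) (N : nat) (theta : 'I_N -> circle R) c :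
  (forall i, theta i = c) -> max_dist theta = 0.
Proof.
(* As [0] is not neutral for [Num.max] on [R], the constant maximum is collapsed by idempotence. *)
move=> thc; rewrite /max_dist big1_idem /= ?maxxx // => p _.
rewrite !thc /circle_dist subrr /circle_norm.
set A := [set _ | _ in _].
have A0 : A 0 by exists 0; rewrite ?normr0 //= pi_zeror.
have lbA : lbound A 0 by move=> _ [r _ <-].
apply/eqP; rewrite eq_le lb_le_inf ?andbT //; last by exists 0.
by apply: ge_inf => //; exists 0.
Qed.

(** * Independence of events on disjoint finite sets of selections *)

Section Independence.
Variables (R : realType) (d : measure_display) (Omega : measurableType d).
Variables (P : probability Omega R) (d' : measure_display).
Variables (E : measurableType d') (I : choiceType) (X : I -> {RV P >-> E}).
Hypothesis indX : mutually_independent X.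

(** Values of [B] outside [s] impose nothing, so cylinders over disjoint lists can be merged by a
    conditional. *)
Definition cylinder (s : seq I) (B : I -> set E) : set Omega :=
  \bigcap_(i in [set` s]) (X i @^-1` B i).

Lemma measurable_cylinder s B :
  (forall i, measurable (B i)) -> measurable (cylinder s B).
Proof.
move=> mB; apply: fin_bigcap_measurable => // i _.
exact: measurable_funPTI.
Qed.

Lemma cylinder_cat s1 s2 B1 B2 : ~~ has (mem s1) s2 ->
  cylinder s1 B1 `&` cylinder s2 B2 =
  cylinder (s1 ++ s2) (fun i => if i \in s1 then B1 i else B2 i).
Proof.
move=> /hasPn s12; apply/seteqP; split=> [omega [h1 h2] i|omega h].
  rewrite /= mem_cat; have [is1 _|_ /= is2] := boolP (i \in s1).
    exact: h1.
  exact: h2.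
split=> i /= si.
  by have := h i; rewrite /= mem_cat si; apply.
have /negPf s1i : i \notin s1 by exact: s12.
by have := h i; rewrite /= mem_cat si orbT s1i; apply.
Qed.

Lemma cylinder_catM s1 s2 B1 B2 : uniq (s1 ++ s2) ->
  (forall i, measurable (B1 i)) -> (forall i, measurable (B2 i)) ->
  P (cylinder s1 B1 `&` cylinder s2 B2) =
  (P (cylinder s1 B1) * P (cylinder s2 B2))%E.
Proof.
move=> us mB1 mB2; have := us; rewrite cat_uniq => /and3P[us1 s12 us2].
rewrite cylinder_cat // /cylinder !indX // ?big_cat /=; last first.
  by move=> i; case: ifP.
congr (_ * _)%E; apply: eq_big_seq => i si; first by rewrite si.
have /negPf-> // : i \notin s1 by exact: hasPn s12 i si.
Qed.

(* The extra cylinder over [s0] is what makes the induction on [n] go through: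
   discarding the complement of a cylinder leaves that cylinder, which is
   merged with the one over [s0]. *)
Lemma prob_cylinder_avoid s0 B0 (s : nat -> seq I) (B : nat -> I -> set E)
    (p0 : R) (p : nat -> R) n :
  (forall i, measurable (B0 i)) -> (forall m i, measurable (B m i)) ->
  P (cylinder s0 B0) = p0%:E -> (forall m, P (cylinder (s m) (B m)) = (p m)%:E) ->
  uniq (s0 ++ flatten [seq s m | m <- iota 0 n]) ->
  P (cylinder s0 B0 `&` \big[setI/setT]_(m < n) ~` cylinder (s m) (B m)) =
  (p0 * \prod_(m < n) (1 - p m))%:E.
Proof.
move=> + mB + Pp; elim: n s0 B0 p0 => [|n IHn] s0 B0 p0 mB0 Pp0.
  by move=> _; rewrite !big_ord0 setIT mulr1.
rewrite -addn1 iotaD map_cat flatten_cat /= cats0 addn1 add0n => us.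
set F := flatten _ in us.
have us0F : uniq (s0 ++ F) by move: us; rewrite catA cat_uniq => /and3P[].
(* Prepares the induction hypothesis for the merged list [s0 ++ s n]. *)
have us0nF : uniq ((s0 ++ s n) ++ F).
  by rewrite (perm_uniq (permEl (perm_catAC s0 (s n) F))) -catA.
have us0n : uniq (s0 ++ s n) by move: us0nF; rewrite cat_uniq => /and3P[].
rewrite !big_ord_recr /=; set A := \big[_/_]_(m < n) _.
have mA : measurable A.
  by apply: bigsetI_measurable => m _; apply/measurableC/measurable_cylinder.
have mC0 := measurable_cylinder s0 mB0.
have mCn := measurable_cylinder (s n) (mB n).
(* Both terms of the difference fall under the induction hypothesis, over [s0] and over [s0 ++ s n];
   the factor [1 - p n] comes out. *)
have -> : P (cylinder s0 B0 `&` (A `&` ~` cylinder (s n) (B n))) =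
    (P (cylinder s0 B0 `&` A) -
     P ((cylinder s0 B0 `&` cylinder (s n) (B n)) `&` A))%E.
  rewrite setIA -setDE setIAC; apply: measureD => //; first exact: measurableI.
  by rewrite ltey_eq fin_num_measure //; exact: measurableI.
rewrite (IHn _ _ _ mB0 Pp0 us0F) cylinder_cat; last first.
  by move: us0n; rewrite cat_uniq => /and3P[].
rewrite (IHn _ _ (p0 * p n)) //.
- by rewrite -EFinB mulrA mulrBr mulr1 [p0 * p n * _]mulrAC.
- by move=> i; case: ifP.
rewrite -cylinder_cat; last by move: us0n; rewrite cat_uniq => /and3P[].
by rewrite cylinder_catM // Pp0 Pp EFinM.
Qed.

Lemma prob_avoid (s : nat -> seq I) (B : nat -> I -> set E) (q : R) n :
  (forall m i, measurable (B m i)) -> q <= 1 ->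
  (forall m, (q%:E <= P (cylinder (s m) (B m)))%E) ->
  uniq (flatten [seq s m | m <- iota 0 n]) ->
  (P (\big[setI/setT]_(m < n) ~` cylinder (s m) (B m)) <= ((1 - q) ^+ n)%:E)%E.
Proof.
move=> mB q1 qP us.
have Pp m : P (cylinder (s m) (B m)) = (fine (P (cylinder (s m) (B m))))%:E.
  by rewrite fineK // fin_num_measure //; exact: measurable_cylinder.
have c0 : cylinder [::] (fun=> setT) = setT by apply/seteqP.
have P0 : P (cylinder [::] (fun=> setT)) = 1%:E by rewrite c0 probability_setT.
(* The empty cylinder, of probability 1, starts the induction. *)
have := prob_cylinder_avoid (n := n) (fun=> measurableT) mB P0 Pp us.
rewrite c0 setTI mul1r => ->; rewrite lee_fin.
rewrite -[n in leRHS]card_ord -prodr_const.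
apply: ler_prod => m _; rewrite lerD2l lerN2 subr_ge0 -!lee_fin -Pp qP andbT.
by apply: probability_le1; exact: measurable_cylinder.
Qed.

Lemma prob_cylinder_ge (s : seq I) (B : I -> set E) (c : R) :
  uniq s -> (forall i, measurable (B i)) -> 0 <= c ->
  (forall i, (c%:E <= P (X i @^-1` B i))%E) ->
  ((c ^+ size s)%:E <= P (cylinder s B))%E.
Proof.
move=> us mB c0 cP; rewrite /cylinder indX // => {us}.
elim: s => [|i s IHs]; first by rewrite big_nil expr0.
by rewrite big_cons exprS EFinM lee_pmul // lee_fin exprn_ge0.
Qed.

End Independence.

(** * Measurability of events about the state *)

Section StateMeasurable.
Variables (R : realType) (N : nat) (d : measure_display).
Variables (Omega : measurableType d) (P : probability Omega R).
Variables (sel : nat -> 'I_N -> {RV P >-> selection N}).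
Variable theta0 : 'I_N -> circle R.

(** [Q] may be arbitrary because the state at time [t] is determined by finitely many selections,
    each with finitely many outcomes. *)
Lemma measurable_gossip_state t (Q : set ('I_N -> circle R)) :
  measurable [set omega | Q (gossip_state sel theta0 t omega)].
Proof.
elim: t Q => [|t IHt] Q /=.
  have [q|q] := pselect (Q theta0).
    by rewrite (_ : [set _ | _] = setT) //; apply/seteqP; split=> omega.
  by rewrite (_ : [set _ | _] = set0) //; apply/seteqP; split=> omega.
pose step (f : {ffun 'I_N -> option 'I_N}) (th : 'I_N -> circle R) k :=
  if f k is Some j then th j else th k.
(* Split according to the joint selection [f] at time [t]; given [f], the event is a condition on
   the state at time [t]. *)
rewrite (_ : [set _ | _] = \bigcup_(f in [set: {ffun 'I_N -> option 'I_N}])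
   ((\bigcap_(k in [set: 'I_N]) (sel t k @^-1` [set (f k : selection N)])) `&`
    [set omega | Q (step f (gossip_state sel theta0 t omega))])); last first.
  apply/seteqP; split=> [omega q|omega [f _ [self]]] /=.
    exists [ffun k => sel t k omega : option 'I_N] => //; split=> [k _|] /=.
      by rewrite ffunE.
    move: q; congr Q; apply/funext => k; by rewrite /step ffunE.
  congr Q; apply/funext => k; rewrite /step.
  by have := self k I => /= ->.
apply: fin_bigcup_measurable => // f _; apply: measurableI; last first.
  exact: (IHt [set th | Q (step f th)]).
apply: fin_bigcap_measurable => // k _.
exact: measurable_funPTI.
Qed.
End StateMeasurable.

(** * Probability of consensus after many blocks *)

Section Synchronization.
Variables (R : realType) (N : nat) (a : nat -> 'I_N -> 'I_N -> R) (beta : R).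
Variables (d : measure_display) (Omega : measurableType d).
Variables (P : probability Omega R) (sel : nat -> 'I_N -> {RV P >-> selection N}).
Hypotheses (ha : is_delta_digraph a) (beta_gt0 : 0 < beta).
Hypothesis hsel : gossip_selections a beta sel.

Lemma admissible_selection_ge : exists2 c : R, 0 < c &
  forall w, admissible a w -> forall t k,
    (c%:E <= P (sel t k @^-1` [set (w t k : selection N)]))%E.
Proof.
case: ha => a_ge0 _ [M aM] [delta delta_gt0 adelta].
have den_gt0 t k : 0 < beta + \sum_(l < N) a t l k.
  by rewrite ltr_pwDl // sumr_ge0.
have den_le t k : beta + \sum_(l < N) a t l k <= beta + `|M| *+ N.
  rewrite lerD2l -[N in leRHS]card_ord -sumr_const ler_sum // => l _.
  exact: le_trans (aM _ _ _) (ler_norm _).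
have D_gt0 : 0 < beta + `|M| *+ N by rewrite ltr_pwDl // mulrn_wge0.
have m_gt0 : 0 < Num.min delta beta by rewrite lt_min delta_gt0.
case: hsel => selS selN _.
(* The numerator bounds edge weights and [beta] from below; the denominator bounds all
   normalizations from above, with [|M|] keeping it positive whatever the sign of [M]. *)
exists (Num.min delta beta / (beta + `|M| *+ N)); first exact: divr_gt0.
move=> w adw t k; case wE : (w t k) => [j|].
  rewrite selS lee_fin ler_pM ?lef_pV2 ?posrE ?invr_ge0 ?(ltW m_gt0) ?(ltW D_gt0) //.
  by rewrite ge_min adelta //; exact: adw.
rewrite selN lee_fin ler_pM ?lef_pV2 ?posrE ?invr_ge0 ?(ltW m_gt0) ?(ltW D_gt0) //.
by rewrite ge_min lexx orbT.
Qed.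

Definition block (L m : nat) : seq (nat * 'I_N) :=
  [seq (t, k) | t <- iota (m * L) L, k <- enum 'I_N].

(** Consecutive blocks tile an initial time interval, which reduces their disjointness to
    duplicate-freeness of a single product list. *)
Lemma flatten_block L n : flatten [seq block L m | m <- iota 0 n] =
  [seq (t, k) | t <- iota 0 (n * L), k <- enum 'I_N].
Proof.
elim: n => [|n IHn] //.
rewrite -addn1 iotaD map_cat flatten_cat IHn /= cats0 addn1 mulSnr iotaD.
by rewrite allpairs_cat.
Qed.

Lemma uniq_allpairs_enum m n :
  uniq [seq (t, k) | t <- iota m n, k <- enum 'I_N].
Proof.
by rewrite allpairs_uniq ?iota_uniq ?enum_uniq // => -[? ?] [? ?] _ _ [-> ->].
Qed.

Lemma driven_gossip theta0 omega :
  driven (fun t k => sel t k omega) (fun t => gossip_state sel theta0 t omega).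
Proof. by []. Qed.

Lemma gossip_consensus_prob (T0 : nat) (k : 'I_N) :
  (forall t, root_connected (union_edge a T0 t) k) ->
  exists2 q : R, 0 < q <= 1 &
    forall (theta0 : 'I_N -> circle R) n t, (n * (N * T0.+1) <= t)%N ->
    ((1 - (1 - q) ^+ n)%:E <= P [set omega |
      exists c, forall i, gossip_state sel theta0 t omega i = c])%E.
Proof.
move=> rootk; set L := (N * T0.+1)%N.
have [c c_gt0 cP] := admissible_selection_ge.
(* The digraph varies in time, so each block needs its own pattern; only the bound on its
   probability is common. *)
have ex_w m : {w : nat -> 'I_N -> option 'I_N | admissible a w /\
    forall x (theta : nat -> 'I_N -> circle R), driven x theta ->
      (forall s l, (m * L <= s < m * L + L)%N -> x s l = w s l) ->
      forall i, theta (m * L + L)%N i = theta (m * L)%N k}.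
  by apply: cid; have [w] := broadcast (circle R) (m * L)%N rootk; exists w.
pose w m := sval (ex_w m).
pose B m (i : nat * 'I_N) := [set (w m i.1 i.2 : selection N)].
have mB m i : measurable (B m i) by [].
case: (hsel) => _ _ indsel.
pose C m := cylinder (fun tk => sel tk.1 tk.2) (block L m) (B m).
have mC m : measurable (C m) by exact: measurable_cylinder.
have PC m : ((c ^+ (L * N))%:E <= P (C m))%E.
  have -> : (L * N)%N = size (block L m).
    by rewrite size_allpairs size_iota size_enum_ord.
  apply: prob_cylinder_ge => //; [exact: uniq_allpairs_enum|exact: ltW|].
  by move=> [t l]; apply: cP; have [] := svalP (ex_w m).
(* One factor [c] for each of the [L * N] selections in a block. *)
exists (c ^+ (L * N)).
  rewrite exprn_gt0 //= -lee_fin (le_trans (PC 0)) //; exact: probability_le1.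
move=> theta0 n t nt.
have mS := measurable_gossip_state sel theta0 t
  [set th | exists c, forall i, th i = c].
have mA : measurable (\big[setI/setT]_(m < n) ~` C m).
  by apply: bigsetI_measurable => m _; exact: measurableC.
(* Consensus at [t] contains the event that some block follows its pattern. *)
apply: (@le_trans _ _ (P (~` \big[setI/setT]_(m < n) ~` C m))).
  rewrite probability_setC // EFinB leeB //.
  apply: prob_avoid => //.
    rewrite -lee_fin (le_trans (PC 0)) //; exact: probability_le1.
  by rewrite flatten_block uniq_allpairs_enum.
apply: le_measure; rewrite ?inE; [exact: measurableC|exact: mS|].
rewrite -(bigcap_mkord _ (fun m => ~` C m)) setC_bigcap => omega [m mn]; rewrite setCK /C => Comega.
have [_ wP] := svalP (ex_w m).
have agree s l : (m * L <= s < m * L + L)%N -> sel s l omega = w m s l.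
  move=> sm; apply: (Comega (s, l)); apply/allpairsP; exists (s, l).
  by rewrite /= mem_iota mem_enum; split.
have := wP _ _ (driven_gossip theta0 omega) agree.
set v := gossip_state _ _ _ _ k => sync; exists v => i.
(* Block [m] ends by time [n * L], hence by [t], and consensus persists from there. *)
have mt : (m * L + L <= t)%N.
  by rewrite -mulSnr (leq_trans _ nt) // leq_mul2r mn orbT.
rewrite -(subnKC mt).
exact: (driven_consensus _ (driven_gossip theta0 omega) sync).
Qed.

End Synchronization.

Unset Implicit Arguments.
Set Strict Implicit.

Theorem proposition6p3 (R : realType) (N : nat) (hN : (1 <= N)%N)
    (a : nat -> 'I_N -> 'I_N -> R) (ha : is_delta_digraph a)
    (hconn : uniformly_connected a)
    (beta : R) (hbeta : 0 < beta)
    (d : measure_display) (Omega : measurableType d) (P : probability Omega R)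
    (sel : nat -> 'I_N -> {RV P >-> selection N})
    (hsel : gossip_selections a beta sel) :
  forall (theta0 : 'I_N -> circle R) (eps kappa : R),
    0 < eps -> 0 < kappa < 1 ->
    exists T : nat, forall t : nat, (T <= t)%N ->
      (kappa%:E <
       P [set omega | max_dist (gossip_state sel theta0 t omega) < eps]%R)%E.
Proof.
move=> theta0 eps kappa eps_gt0 /andP[_ kappa_lt1].
have [T0 [k rootk]] := hconn.
have [q /andP[q_gt0 q_le1] qP] := gossip_consensus_prob ha hbeta hsel rootk.
have q1 : `|1 - q| < 1 by rewrite ger0_norm ?subr_ge0 // gtrBl.
(* Geometric decay supplies the number [n] of blocks, from [kappa] alone once [q] is fixed; [eps]
   enters only through [0 < eps], since consensus makes the maximal distance exactly 0. *)
have [n _ /(_ n (leqnn n)) /= qn] : \forall n \near \oo, (1 - q) ^+ n < 1 - kappa.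
  by apply: cvgr_lt (cvg_expr q1) _ _; rewrite subr_gt0.
exists (n * (N * T0.+1))%N => t nt.
apply: (@lt_le_trans _ _ (1 - (1 - q) ^+ n)%:E).
  by rewrite lte_fin ltrBrDr addrC -ltrBrDr.
apply: le_trans (qP theta0 n t nt) _.
apply: le_measure; rewrite ?inE.
- exact: (measurable_gossip_state _ _ _ [set th | exists c, forall i, th i = c]).
- exact: (measurable_gossip_state _ _ _ [set th | max_dist th < eps]).
by move=> omega [c /max_dist_consensus] /= ->.
Qed.
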